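(* Let $\Omega$, $C_i$, $\mathbf{f}_i$, $b_i$ ($i\in I=\{1,\dots,k\}$), the space $H$, the finite set of collocation points $Z\subseteq\Omega$, the subsets $X_i=Z\cap C_i=\{\mathbf{x}_i^1,\dots,\mathbf{x}_i^{L_i}\}$, the index sets $P^\theta=\{p_1^\theta,\dots,p_{\mathcal{P}^\theta}^\theta\}$ and the subsets $Y^\theta=Z\cap\Omega^{P^\theta}=\{\mathbf{y}^{1,\theta},\dots,\mathbf{y}^{M^\theta,\theta}\}$ ($\theta=1,\dots,\Theta$) be as in the context. Then the minimisation problem $$\min\{\|v\|_H: v\in H,\ \nabla v(\mathbf{y}^{m,\theta})\cdot\mathbf{f}_{p_j^\theta}(\mathbf{y}^{m,\theta})\le b_{p_j^\theta}(\mathbf{y}^{m,\theta})\text{ for all }\theta=1,\dots,\Theta,\ m=1,\dots,M^\theta,\ j=1,\dots,\mathcal{P}^\theta\}$$ is equivalent to the minimisation problem $$\min\{\|v\|_H: v\in H,\ \nabla v(\mathbf{x}_i^\ell)\cdot\mathbf{f}_i(\mathbf{x}_i^\ell)\le b_i(\mathbf{x}_i^\ell)\text{ for all }i=1,\dots,k,\ \ell=1,\dots,L_i\},$$ i.e. a function $v\in H$ satisfies the constraints of the first problem if and only if it satisfies the constraints of the second.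
   Context: $\Omega\subseteq\mathbb{R}^d$ is a bounded domain with Lipschitz boundary and $\mathbf{0}\in\Omega^\circ$; $I=\{1,\dots,k\}$; the sets $C_i\subseteq\Omega$ are closed with $\bigcup_{i\in I}C_i=\Omega$; $\mathbf{f}_i$ is the restriction to $C_i$ of a $C^{\alpha-1}$ vector field on an open neighbourhood of $C_i$, with $\alpha>d/2+2$, and $\mathbf{f}_i(\mathbf{0})=\mathbf{0}$ if $\mathbf{0}\in C_i$. The functions $b_i:C_i\to\mathbb{R}$ are continuous, negative on $C_i\setminus\{\mathbf{0}\}$, with $b_i(\mathbf{0})=0$. $H=H^\alpha(\Omega)$ is the Sobolev space $W^{\alpha,2}(\Omega)$, a reproducing kernel Hilbert space, with norm $\|\cdot\|_H$ (equivalent to the standard one). For $\emptyset\ne P\subseteq I$ define $\Omega^P:=\left(\bigcap_{i\in P}C_i\right)\cap\left(\bigcap_{j\in I\setminus P}C_j^c\right)$. Let $\Theta$ be the number of nonempty subsets $P\subseteq I$ for which $\Omega^P\neq\emptyset$; label these subsets $P^1,\dots,P^\Theta$ and write $P^\theta=\{p_1^\theta,\dots,p_{\mathcal{P}^\theta}^\theta\}$ with $\mathcal{P}^\theta=|P^\theta|$. $Z=\{\mathbf{z}^1,\dots,\mathbf{z}^N\}\subseteq\Omega$ is a fixed finite set of collocation points; $X_i:=Z\cap C_i$ has $L_i$ elements ($0\le L_i\le N$) denoted $\mathbf{x}_i^1,\dots,\mathbf{x}_i^{L_i}$; $Y^\theta:=Z\cap\Omega^{P^\theta}$ has $M^\theta$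 elements denoted $\mathbf{y}^{1,\theta},\dots,\mathbf{y}^{M^\theta,\theta}$. *)

(* Defs.v *)
From HB Require Import structures.
From mathcomp Require Import all_boot all_order all_algebra.
From mathcomp Require Import all_classical all_reals all_analysis.

Set Implicit Arguments.
Unset Strict Implicit.
Unset Printing Implicit Defensive.

Import Order.TTheory GRing.Theory Num.Theory.
Import numFieldNormedType.Exports.

Local Open Scope classical_set_scope.
Local Open Scope ring_scope.

(** * Lebesgue measure on R^n, carried by n-tuples of reals *)

Definition consT {R : realType} n
    (p : measurableTypeR R * n.-tuple (measurableTypeR R)) :
    n.+1.-tuple (measurableTypeR R) := [tuple of p.1 :: p.2].

Lemma measurable_consT {R : realType} n :
  measurable_fun [set: measurableTypeR R * n.-tuple (measurableTypeR R)]
    (@consT R n).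
Proof. exact: measurable_cons. Qed.

Definition leb1 {R : realType} :
  {sigma_finite_measure set (measurableTypeR R) -> \bar R} := lebesgue_measure.

Lemma sigma_finite_prod d1 d2 (T1 : measurableType d1) (T2 : measurableType d2)
    (R : realType) (m1 : {sigma_finite_measure set T1 -> \bar R})
    (m2 : {sigma_finite_measure set T2 -> \bar R}) :
  sigma_finite setT (m1 \x m2)%E.
Proof.
have /sigma_finiteP[F [TF ndF Foo]] := sigma_finiteT m1.
have /sigma_finiteP[G [TG ndG Goo]] := sigma_finiteT m2.
exists (fun n => F n `*` G n).
 rewrite -setXTT TF TG predeqE => -[x y]; split.
    move=> [/= [n _ Fnx] [k _ Gky]]; exists (maxn n k) => //; split.
    - by move: x Fnx; exact/subsetPset/ndF/leq_maxl.
    - by move: y Gky; exact/subsetPset/ndG/leq_maxr.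
  by move=> [n _ []/= ? ?]; split; exists n.
move=> k; have [? ?] := Foo k; have [? ?] := Goo k.
split; first exact: measurableX.
by rewrite product_measure1E// lte_mul_pinfty// ge0_fin_numE.
Qed.

Section lebesgue_step.
Context {R : realType} (n : nat).
Variable mu : {sigma_finite_measure set (n.-tuple (measurableTypeR R)) -> \bar R}.

Definition leb_step : set (n.+1.-tuple (measurableTypeR R)) -> \bar R :=
  pushforward (leb1 \x mu)%E (@consT R n).

Let leb_step0 : leb_step set0 = 0%E.
Proof. by rewrite /leb_step /pushforward preimage_set0 measure0. Qed.

Let leb_step_ge0 A : (0 <= leb_step A)%E.
Proof. by rewrite /leb_step /pushforward measure_ge0. Qed.

Let leb_step_sigma_additive : semi_sigma_additive leb_step.
Proof.
move=> F mF tF mUF; rewrite /leb_step /pushforward preimage_bigcup.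
apply: measure_semi_sigma_additive.
- by move=> k; rewrite -[X in measurable X]setTI; exact: measurable_consT.
- apply/trivIsetP => i j _ _ ij; rewrite -preimage_setI.
  by move/trivIsetP : tF => ->//; rewrite preimage_set0.
- by rewrite -preimage_bigcup -[X in measurable X]setTI;
    exact: measurable_consT.
Qed.

HB.instance Definition _ := isMeasure.Build _ _ _ leb_step
  leb_step0 leb_step_ge0 leb_step_sigma_additive.

Let leb_step_sigma_finite : sigma_finite setT leb_step.
Proof.
have [F TF Foo] := sigma_finite_prod leb1 mu.
pose uncons (t : n.+1.-tuple (measurableTypeR R)) :=
  (thead t, [tuple of behead t]) : measurableTypeR R * n.-tuple (measurableTypeR R).
have consK : cancel (@consT R n) uncons.
  by case=> x t; congr (_, _); apply: val_inj.
have munc : measurable_fun setT uncons.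
  apply: measurable_fun_pair; first exact: measurable_tnth.
  exact: measurable_behead.
exists (fun i => uncons @^-1` F i).
  by rewrite -preimage_bigcup -TF preimage_setT.
move=> i; have [mFi Fioo] := Foo i; split.
  by rewrite -[X in measurable X]setTI; exact: munc.
rewrite /leb_step /pushforward -comp_preimage.
by rewrite (_ : uncons \o _ = id)//; apply/funext => x; exact: consK.
Qed.

HB.instance Definition _ := Measure_isSigmaFinite.Build _ _ _ leb_step
  leb_step_sigma_finite.

End lebesgue_step.

Fixpoint leb {R : realType} (n : nat) :
    {sigma_finite_measure set (n.-tuple (measurableTypeR R)) -> \bar R} :=
  match n with
  | 0 => \d_([tuple] : 0.-tuple (measurableTypeR R))
  | n'.+1 => leb_step (leb n')
  end.

Definition rv {R : realType} {n} (t : n.-tuple (measurableTypeR R)) : 'rV[R]_n :=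
  \row_i tnth t i.

(** [leb_integral O g] is the Lebesgue integral over [O] of an extended real valued
    function on R^n *)
Definition leb_integral {R : realType} {n} (O : set 'rV[R]_n)
    (g : 'rV[R]_n -> \bar R) : \bar R :=
  (\int[leb n]_(t in rv @^-1` O) g (rv t))%E.

Section calculus.
Context {R : realType} {d : nat}.
Implicit Types (O U : set 'rV[R]_d) (v w phi : 'rV[R]_d -> R).

Definition dot (x y : 'rV[R]_d) : R := \sum_j x 0 j * y 0 j.

Definition enorm (x : 'rV[R]_d) : R := Num.sqrt (dot x x).

Definition partial (j : 'I_d) v : 'rV[R]_d -> R :=
  fun x => 'D_(delta_mx 0 j) v x.

Definition partials (s : seq 'I_d) v : 'rV[R]_d -> R := foldr partial v s.

(** C^k on an open set [U] *)
Definition Ck (k : nat) U v :=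
  forall s, (size s <= k)%N -> forall x, U x ->
    {for x, continuous (partials s v)} /\
    ((size s < k)%N -> forall j, derivable (partials s v) x (delta_mx 0 j)).

(** C^beta on an open set [U], for a real [beta >= 0]: C^k with k the integer
    part of [beta] and, if [beta] is not an integer, derivatives of order k that
    are locally Hoelder continuous of exponent [beta - k] *)
Definition Cbeta (beta : R) U v :=
  let k := Num.truncn beta in
  let e := beta - k%:R in
  Ck k U v /\
  (0 < e -> forall s, size s = k -> forall x, U x ->
     exists2 r : R, 0 < r & exists M : R, forall y z,
       ball x r y -> ball x r z ->
       `|partials s v y - partials s v z| <= M * `|y - z| `^ e).

Definition test_fun O phi :=
  (forall k, Ck k [set: 'rV[R]_d] phi) /\
  (exists2 K, compact K /\ K `<=` O & forall x, ~ K x -> phi x = 0).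

(** The gradient at points of [Om]; at a boundary point it is the limit of the
    gradients at the interior points *)
Definition grad (Om : set 'rV[R]_d) v (y : 'rV[R]_d) : 'rV[R]_d :=
  \row_j (if y \in (Om° : set _) then partial j v y
          else lim (partial j v x @[x --> within Om° (nbhs y)])).

End calculus.

Section sobolev.
Context {R : realType} {d : nat}.
Implicit Types (O : set 'rV[R]_d) (v w phi : 'rV[R]_d -> R).

Definition L2 O w :=
  measurable_fun (rv @^-1` O) (w \o rv) /\
  (leb_integral O (fun x => (w x ^+ 2)%:E) < +oo)%E.

Definition mdeg (a : 'I_d -> nat) : nat := (\sum_i a i)%N.

Definition mpartial (a : 'I_d -> nat) phi :=
  partials (flatten [seq nseq (a i) i | i <- enum 'I_d]) phi.

Definition weak_deriv O (a : 'I_d -> nat) v w :=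
  L2 O w /\ forall phi, test_fun O phi ->
    leb_integral O (fun x => (v x * mpartial a phi x)%:E) =
    (((-1) ^+ mdeg a)%:E * leb_integral O (fun x => (w x * phi x)%:E))%E.

(** A representative of the weak derivative; it is unique up to a null set *)
Definition wderiv O (a : 'I_d -> nat) v : 'rV[R]_d -> R :=
  xget (fun=> 0) [set w | weak_deriv O a v w].

(** The squared Gagliardo seminorm of order [e] *)
Definition gagliardo O (e : R) w : \bar R :=
  leb_integral O (fun x => leb_integral O (fun y =>
    ((w x - w y) ^+ 2 / enorm (x - y) `^ (d%:R + 2 * e))%:E)).

(** The multi-indices of degree at most [m] have entries at most [m] *)
Definition mindex (m : nat) (a : {ffun 'I_d -> 'I_m.+1}) : 'I_d -> nat :=
  fun i => a i.

(** The square of the (Sobolev-Slobodeckij) norm of W^{alpha,2}(O), with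
    alpha = m + e, m a natural number and 0 <= e < 1 *)
Definition sobolev_sqnorm O (alpha : R) v : \bar R :=
  let m := Num.truncn alpha in
  let e := alpha - m%:R in
  ((\sum_(a : {ffun 'I_d -> 'I_m.+1} | (mdeg (mindex a) <= m)%N)
      leb_integral O (fun x => (wderiv O (mindex a) v x ^+ 2)%:E)) +
   (if (0 < e)%R then
      \sum_(a : {ffun 'I_d -> 'I_m.+1} | mdeg (mindex a) == m)
        gagliardo O e (wderiv O (mindex a) v)
    else 0))%E.

Definition sobolev O (alpha : R) : set ('rV[R]_d -> R) :=
  [set v | L2 O v /\
           (forall a, (mdeg a <= Num.truncn alpha)%N ->
              exists w, weak_deriv O a v w) /\
           (sobolev_sqnorm O alpha v < +oo)%E].

Definition sobolev_norm O (alpha : R) v : R :=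
  Num.sqrt (fine (sobolev_sqnorm O alpha v)).

(** H^alpha(Om) for alpha > d/2, as a space of functions on [Om]: each class of
    W^{alpha,2} is represented by its continuous member. Functions on [Om] are
    encoded as functions on R^d that vanish outside [Om]. *)
Definition Hspace (Om : set 'rV[R]_d) (alpha : R) : set ('rV[R]_d -> R) :=
  [set v | (forall x, ~ Om x -> v x = 0) /\
           {within Om, continuous v} /\ sobolev Om° alpha v].

(** [Om] is not required to be open or closed: it lies between the open
    connected set [Om°] and its closure, and near each boundary point [Om°]
    is, in suitable orthonormal coordinates, the set of points above the graph
    of a Lipschitz function. *)
Definition lipschitz_domain (Om : set 'rV[R]_d) :=
  [/\ connected Om°, Om° !=set0, Om `<=` closure Om° &
   forall x, (closure Om `\` Om°) x ->
     exists (A : 'M[R]_d) (j : 'I_d) (gam : 'rV[R]_d.-1 -> R) (r : R),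
       [/\ A *m A^T = 1%:M, lipschitz gam, 0 < r &
        forall y, ball x r y ->
          (Om° y <-> gam (col' j (y *m A)) < (y *m A) 0 j)]].

End sobolev.

(** [H], with the inner product [ip], is a reproducing kernel Hilbert space of
    functions on [D] *)
Record is_rkhs {R : realType} {T : Type} (D : set T) (H : set (T -> R))
    (ip : (T -> R) -> (T -> R) -> R) : Prop := {
  rkhs_zero : H (fun=> 0);
  rkhs_lin : forall (c : R) u v, H u -> H v -> H (fun x => c * u x + v x);
  rkhs_ip_sym : forall u v, H u -> H v -> ip u v = ip v u;
  rkhs_ip_lin : forall (c : R) u v w, H u -> H v -> H w ->
    ip (fun x => c * u x + v x) w = c * ip u w + ip v w;
  rkhs_ip_pos : forall v, H v -> v <> (fun=> 0) -> 0 < ip v v;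
  rkhs_complete : forall u : nat -> T -> R, (forall n, H (u n)) ->
    (forall e, 0 < e -> exists N, forall n p, (N <= n)%N -> (N <= p)%N ->
       ip (u n \- u p) (u n \- u p) < e) ->
    exists2 v, H v & ip (u n \- v) (u n \- v) @[n --> \oo] --> 0;
  rkhs_kernel : forall x, D x ->
    exists2 kx, H kx & forall v, H v -> ip v kx = v x }.

Definition hnorm {R : realType} {T : Type} (ip : (T -> R) -> (T -> R) -> R)
  (v : T -> R) : R := Num.sqrt (ip v v).

Definition equivalent_norms {R : realType} {T : Type} (H : set (T -> R))
    (N1 N2 : (T -> R) -> R) :=
  exists c C : R, [/\ 0 < c, 0 < C &
    forall v, H v -> c * N2 v <= N1 v <= C * N2 v].

(** [Omega_P C P] is the set of points that lie in [C i] exactly for the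
    indices [i] in [P] *)
Definition Omega_P {T : Type} {k : nat} (C : 'I_k -> set T) (P : {set 'I_k}) :
    set T :=
  (\bigcap_(i in [set i | i \in P]) C i) `&`
  (\bigcap_(j in [set j | j \notin P]) ~` C j).

(** [e 0, ..., e (n-1)] list the elements of [A] without repetition *)
Definition enumerates {T : Type} {n : nat} (e : 'I_n -> T) (A : set T) :=
  set_bij [set: 'I_n] A e.

(** [v] solves the problem: minimise [N] over [A] *)
Definition minimiser {R : realType} {X : Type} (N : X -> R) (A : set X) (v : X) :=
  A v /\ forall w, A w -> N v <= N w.

(* Main.v *)
Require Import Defs.
From HB Require Import structures.
From mathcomp Require Import all_boot all_order all_algebra.
From mathcomp Require Import all_classical all_reals all_analysis.

Set Implicit Arguments.
Unset Strict Implicit.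
Unset Printing Implicit Defensive.

Import Order.TTheory GRing.Theory Num.Theory.
Import numFieldNormedType.Exports.

Local Open Scope classical_set_scope.
Local Open Scope ring_scope.

(** Both problems impose, for every collocation point [u] and every index [i]
    with [C i u], the same inequality on the gradient at [u].  The second problem
    lists these pairs [(i, u)] index by index; the first lists them cell by cell,
    where the cells [Omega_P C Q] over nonempty index sets [Q] are pairwise
    disjoint and cover the union of the [C i].  The two lists contain the same pairs ([cellwise_constraintsP]), so the two
    feasible sets, and hence the minimisers of any functional over them,
    coincide. *)

Lemma forall_enumerates {T : Type} {n : nat} (e : 'I_n -> T) (A : set T)
    (Q : T -> Prop) :
  enumerates e A -> (forall m, Q (e m)) <-> (forall a, A a -> Q a).
Proof.
move=> [eA _ Ae]; split=> [Qe a /Ae[m _ <-] //|QA m].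
by apply/QA/eA.
Qed.

Section active_set.
Context {T : Type} {k : nat} (C : 'I_k -> set T).

Definition active (u : T) : {set 'I_k} := finset (fun i => `[< C i u >]).

Lemma in_active i u : (i \in active u) = `[< C i u >].
Proof. by rewrite inE. Qed.

Lemma Omega_P_active u : Omega_P C (active u) u.
Proof.
split=> i /=; first by rewrite in_active => /asboolP.
by rewrite in_active => /asboolPn.
Qed.

(** A pair [(i, u)] met in a cell satisfies [C i u] by definition of the cell.
    Conversely, if [C i u], then [u] lies in the cell of [active C u]; this index
    set contains [i], so both it and its cell are nonempty, and it is one of those
    enumerated by [P]. *)
Lemma cellwise_constraintsP (Z : set T) (Theta : nat)
    (P : 'I_Theta -> {set 'I_k}) (K : 'I_k -> T -> Prop) :
  enumerates P [set Q : {set 'I_k} | (0 < #|Q|)%N /\ Omega_P C Q !=set0] ->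
  (forall theta u, (Z `&` Omega_P C (P theta)) u ->
     forall i, i \in P theta -> K i u) <->
  (forall i u, (Z `&` C i) u -> K i u).
Proof.
move=> enumP; split=> [KP i u [Zu Ciu]|KC theta u [Zu [CPu _]] i iP]; last first.
  by apply: KC; split=> //; exact: CPu.
have iu : i \in active u by rewrite in_active; exact/asboolP.
have [_ _ /(_ (active u))[|theta _ Ptheta]] := enumP.
  split; last by exists u; exact: Omega_P_active.
  by apply/card_gt0P; exists i.
apply: (KP theta); rewrite Ptheta //.
by split=> //; exact: Omega_P_active.
Qed.

End active_set.

Theorem lemma4p2 (R : realType) (d k : nat) (alpha : R)
    (Om : set 'rV[R]_d) (C : 'I_k -> set 'rV[R]_d)
    (f : 'I_k -> 'rV[R]_d -> 'rV[R]_d) (b : 'I_k -> 'rV[R]_d -> R)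
    (ip : ('rV[R]_d -> R) -> ('rV[R]_d -> R) -> R)
    (N : nat) (Z : set 'rV[R]_d) (z : 'I_N -> 'rV[R]_d)
    (L : 'I_k -> nat) (x : forall i, 'I_(L i) -> 'rV[R]_d)
    (Theta : nat) (P : 'I_Theta -> {set 'I_k})
    (p : forall theta, 'I_#|P theta| -> 'I_k)
    (M : 'I_Theta -> nat) (y : forall theta, 'I_(M theta) -> 'rV[R]_d) :
  (0 < d)%N ->
  d%:R / 2 + 2 < alpha ->
  bounded_set Om -> lipschitz_domain Om -> Om° 0 ->
  (forall i, closed (C i)) -> (forall i, C i `<=` Om) ->
  \bigcup_i C i = Om ->
  (forall i, exists (U : set 'rV[R]_d) (g : 'rV[R]_d -> 'rV[R]_d),
     [/\ open U, C i `<=` U,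
         forall j, Cbeta (alpha - 1) U (fun u => g u 0 j) &
         forall u, C i u -> f i u = g u]) ->
  (forall i, C i 0 -> f i 0 = 0) ->
  (forall i, {within C i, continuous (b i)}) ->
  (forall i u, C i u -> u <> 0 -> b i u < 0) ->
  (forall i, C i 0 -> b i 0 = 0) ->
  is_rkhs Om (Hspace Om alpha) ip ->
  equivalent_norms (Hspace Om alpha) (hnorm ip) (sobolev_norm Om° alpha) ->
  enumerates z Z -> Z `<=` Om ->
  (forall i, enumerates (x i) (Z `&` C i)) ->
  enumerates P [set Q : {set 'I_k} | (0 < #|Q|)%N /\ Omega_P C Q !=set0] ->
  (forall theta, enumerates (p theta) [set i | i \in P theta]) ->
  (forall theta, enumerates (y theta) (Z `&` Omega_P C (P theta))) ->
  let feasible1 v :=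
    Hspace Om alpha v /\
    forall theta (m : 'I_(M theta)) (j : 'I_#|P theta|),
      dot (grad Om v (y theta m)) (f (p theta j) (y theta m))
        <= b (p theta j) (y theta m) in
  let feasible2 v :=
    Hspace Om alpha v /\
    forall i (l : 'I_(L i)),
      dot (grad Om v (x i l)) (f i (x i l)) <= b i (x i l) in
  (forall v, Hspace Om alpha v -> (feasible1 v <-> feasible2 v)) /\
  (forall v, minimiser (hnorm ip) [set w | feasible1 w] v <->
             minimiser (hnorm ip) [set w | feasible2 w] v).
Proof.
move=> _ _ _ _ _ _ _ _ _ _ _ _ _ _ _ _ _ enumx enumP enump enumy.
move=> feasible1 feasible2.
have feasibleE v : feasible1 v <-> feasible2 v.
  pose K i u := dot (grad Om v u) (f i u) <= b i u.
  have cells := cellwise_constraintsP Z K enumP.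
  have byindex i := forall_enumerates (K i) (enumx i).
  have bypoint theta :=
    forall_enumerates (fun u => forall j, K (p theta j) u) (enumy theta).
  have bymember theta u := forall_enumerates (K^~ u) (enump theta).
  split=> -[Hv Kv]; split=> //.
  - move=> i; apply/byindex; move: i; apply/cells => theta u Yu.
    by apply/bymember; move: u Yu; exact/bypoint/Kv.
  - move=> theta; apply/bypoint => u Yu; apply/bymember; move: theta u Yu.
    by apply/cells => i; exact/byindex/Kv.
split=> // v.
suff -> : [set w | feasible1 w] = [set w | feasible2 w] by [].
by apply/funext => w; exact/propext.
Qed.
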